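(* Let $q=2^e$ with $e>1$ an odd integer, let $b\in\mathrm{GF}(q^2)\setminus\mathrm{GF}(q)$, and let $\varepsilon\in\mathrm{GF}(q^2)\setminus\mathrm{GF}(q)$ satisfy $\varepsilon^2+\varepsilon+\delta=0$ for some $\delta\in\mathrm{GF}(q)\setminus\{1\}$ with $\mathrm{Tr}(\delta)=1$. Let $$\mathcal U_b=\{(1,x,bx^{q+1}+r)\mid x\in\mathrm{GF}(q^2),\ r\in\mathrm{GF}(q)\}\cup\{Y_\infty\},$$ a classical unital in $\mathrm{PG}(2,q^2)$. Then $\mathcal U_b$, regarded as a set of points of the projective closure of the affine plane $\mathfrak A'_\varepsilon$, is the non-classical B-T unital $U_\varepsilon$; that is, in the coordinates $(\xi,\eta)$ of $\mathfrak A'_\varepsilon$ it is the set $U_\varepsilon=\{(1,\xi,f(\xi)\varepsilon+r)\mid \xi\in\mathrm{GF}(q^2),\ r\in\mathrm{GF}(q)\}\cup\{Y_\infty\}$, and this is a non-classical B-T unital in the projective closure of $\mathfrak A'_\varepsilon$.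
   Context: Coordinates: $\mathrm{PG}(2,q^2)$ has homogeneous coordinates $(x_0,x_1,x_2)$; $\mathrm{AG}(2,q^2)$ is obtained by deleting the line $x_0=0$, with affine coordinates $x=x_1/x_0$, $y=x_2/x_0$; $Y_\infty=(0,0,1)$ is the infinite point of the vertical lines $x=k$. $\mathrm{Tr}:\mathrm{GF}(q)\to\mathrm{GF}(2)$ is the trace. $\sigma$ is the automorphism $z\mapsto z^{2^{(e+1)/2}}$ of $\mathrm{GF}(q)$, and $z^{\sigma+2}$ means $z^\sigma z^2$. For $x\in\mathrm{GF}(q^2)$ put $$f(x)=((x^q+x)\varepsilon+x)^{\sigma+2}+(x^q+x)^\sigma+((x^q+x)\varepsilon+x)(x^q+x).$$ (Here $x^q+x$ and $(x^q+x)\varepsilon+x$ lie in $\mathrm{GF}(q)$; writing $x=s+t\varepsilon$ with $s,t\in\mathrm{GF}(q)$ one has $t=x^q+x$, $s=(x^q+x)\varepsilon+x$ and $f(x)=s^{\sigma+2}+t^\sigma+st$.) The plane $\mathfrak A'_\varepsilon$: its points are the points of $\mathrm{AG}(2,q^2)$; its lines are the vertical lines $x=k$ and the curves $\mathcal D(m,d)$ with equation $y=f(x)\varepsilon+bx^{q+1}+mx+d$, with $k,m,d\in\mathrm{GF}(q^2)$. It is an affine plane isomorphic to $\mathrm{AG}(2,q^2)$. A point of $\mathfrak A'_\varepsilon$ has $\mathfrak A'_\varepsilon$-coordinates $(\xi,\eta)$ when, as a point of $\mathrm{AG}(2,q^2)$, it has coordinates $x=\xi$, $y=\eta+f(\xi)\varepsilon+b\xi^{q+1}$;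 in these coordinates the lines of $\mathfrak A'_\varepsilon$ are $\xi=k$ and $\eta=m\xi+d$. The projective closure of $\mathfrak A'_\varepsilon$ is obtained by adding its points at infinity in the usual way, and is identified with a copy of $\mathrm{PG}(2,q^2)$ in which the affine point $(\xi,\eta)$ has homogeneous coordinates $(1,\xi,\eta)$; the infinite point of the vertical lines is identified with $Y_\infty$. A unital in (a copy of) $\mathrm{PG}(2,q^2)$ is a set of $q^3+1$ points met by every line in either $1$ or $q+1$ points; it is classical if it is the set of absolute points of a non-degenerate unitary polarity, i.e. the point set of a non-degenerate Hermitian curve. For an element $\varepsilon$ as in the claim, $U_\varepsilon=\{(1,x,f(x)\varepsilon+r)\mid x\in\mathrm{GF}(q^2),\ r\in\mathrm{GF}(q)\}\cup\{Y_\infty\}$. The B-T (Buekenhout–Tits) unitals of $\mathrm{PG}(2,q^2)$ are, up to projective equivalence, exactly the sets $U_\varepsilon$ for such $\varepsilon$ (this known characterization may be taken as the definition). *)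

(* Defs.v *)
From HB Require Import structures.
From mathcomp Require Import all_boot all_algebra.

Set Implicit Arguments.
Unset Strict Implicit.
Unset Printing Implicit Defensive.

Import GRing.Theory.
Local Open Scope ring_scope.

Section FiniteVspace.

(* The subtype structure of [{vspace V}] is only visible in this module. *)
Import VectorInternalTheory.

HB.instance Definition _ (K : finFieldType) (V : vectType K) :=
  [Countable of {vspace V} by <:].
HB.instance Definition _ (K : finFieldType) (V : vectType K) :=
  [Finite of {vspace V} by <:].

End FiniteVspace.

Section AffinePlane.

(* An affine plane is given by its point type and its set of lines. *)
Variables (T : finType) (lines : {set {set T}}).

Definition parallel_class (l : {set T}) : {set {set T}} :=
  [set m in lines | (l == m) || [disjoint l & m]].

Definition parallel_classes : {set {set {set T}}} :=
  [set parallel_class l | l in lines].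

(* The points of the projective closure: [inl p] is an affine point, [inr C]
   the point at infinity of the lines in the parallel class [C].  Elements
   [inr C] with [C] not a parallel class are junk outside this set. *)
Definition closure_points : {set T + {set {set T}}} :=
  [set inl p | p : T] :|: [set inr C | C in parallel_classes].

Definition closure_lines : {set {set T + {set {set T}}}} :=
  [set inr (parallel_class l) |: [set inl p | p in l] | l : {set T} in lines]
  :|: [set [set inr C | C in parallel_classes]].

End AffinePlane.

Section ProjectivePlane.

(* The points and lines of PG(2, K) are the subspaces of [K^3] of dimension 1
   and 2; a line is identified with the set of its points. *)
Variable K : finFieldType.

Definition pg_points : {set {vspace 'rV[K]_3}} := [set P | \dim P == 1%N].

Definition pg_lines : {set {set {vspace 'rV[K]_3}}} :=
  [set [set P in pg_points | (P <= L)%VS] |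
    L : {vspace 'rV[K]_3} & \dim L == 2%N].

Definition hpt (a b c : K) : {vspace 'rV[K]_3} :=
  <[\row_(i < 3) [:: a; b; c]`_i]>%VS.

Definition Yinf : {vspace 'rV[K]_3} := hpt 0 0 1.

End ProjectivePlane.

Section Unitals.

(* Throughout, q = 2 ^ e and K is meant to have q ^ 2 elements. *)
Variables (e : nat) (K : finFieldType).

Let q : nat := (2 ^ e)%N.

Definition GFq : {set K} := [set z | z ^+ q == z].

(* For z in GF(q), the value of Tr : GF(q) -> GF(2), seen inside K. *)
Definition Tr (z : K) : K := \sum_(i < e) z ^+ (2 ^ i).

Definition sigma (z : K) : K := z ^+ (2 ^ (e.+1)./2).

Definition BT_parameter (eps : K) : Prop :=
  eps \notin GFq /\
  exists delta : K, [/\ delta \in GFq, delta != 1, Tr delta = 1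
                      & eps ^+ 2 + eps + delta = 0].

Definition f (eps x : K) : K :=
  let t := x ^+ q + x in
  let s := t * eps + x in
  sigma s * s ^+ 2 + sigma t + s * t.

Definition unital (S : {set {vspace 'rV[K]_3}}) : Prop :=
  [/\ S \subset pg_points K,
      #|S| = (q ^ 3 + 1)%N
    & forall l, l \in pg_lines K ->
        #|S :&: l| = 1%N \/ #|S :&: l| = (q + 1)%N].

(* The zero locus of the Hermitian form with matrix H. *)
Definition hermitian_curve (H : 'M[K]_3) : {set {vspace 'rV[K]_3}} :=
  [set <[v]>%VS | v : 'rV[K]_3 &
    (v != 0) && (v *m H *m (map_mx (fun z => z ^+ q) v)^T == 0)].

Definition classical (S : {set {vspace 'rV[K]_3}}) : Prop :=
  exists H : 'M[K]_3,
    [/\ H^T = map_mx (fun z => z ^+ q) H, H \in unitmx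
      & S = hermitian_curve H].

Definition U_eps (eps : K) : {set {vspace 'rV[K]_3}} :=
  [set hpt 1 x (f eps x * eps + r) | x : K, r : K in GFq] :|: [set Yinf K].

Definition U_b (b : K) : {set {vspace 'rV[K]_3}} :=
  [set hpt 1 x (b * x ^+ q.+1 + r) | x : K, r : K in GFq] :|: [set Yinf K].

(* Buekenhout-Tits unitals, defined through their known description as the sets
   projectively equivalent to some [U_eps eps]. *)
Definition BT_unital (S : {set {vspace 'rV[K]_3}}) : Prop :=
  exists eps : K, BT_parameter eps /\
  exists g : 'M[K]_3, g \in unitmx /\
    S = [set (linfun (mulmxr g) @: P)%VS | P in U_eps eps].

Definition vertical_line (k : K) : {set K * K} := [set p | p.1 == k].

Definition curveD (eps b m d : K) : {set K * K} :=
  [set p | p.2 == f eps p.1 * eps + b * p.1 ^+ q.+1 + m * p.1 + d].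

Definition A'_lines (eps b : K) : {set {set K * K}} :=
  [set vertical_line k | k : K] :|: [set curveD eps b m d | m : K, d : K].

Definition vertical_infinity (eps b : K) : (K * K) + {set {set K * K}} :=
  inr (parallel_class (A'_lines eps b) (vertical_line 0)).

(* The point of AG(2, q^2) whose coordinates in the plane A' are (xi, eta). *)
Definition A'_point (eps b xi eta : K) : K * K :=
  (xi, eta + f eps xi * eps + b * xi ^+ q.+1).

(* phi identifies the projective closure of A' with PG(2, q^2), as prescribed
   on the affine points and on the infinite point of the vertical lines.  The
   values of phi outside [closure_points] are irrelevant. *)
Definition A'_identification (eps b : K)
    (phi : (K * K) + {set {set K * K}} -> {vspace 'rV[K]_3}) : Prop :=
  [/\ {in closure_points (A'_lines eps b) &, injective phi},
      phi @: closure_points (A'_lines eps b) = pg_points K,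
      [set phi @: l | l : {set _} in closure_lines (A'_lines eps b)]
        = pg_lines K,
      forall xi eta, phi (inl (A'_point eps b xi eta)) = hpt 1 xi eta
    & phi (vertical_infinity eps b) = Yinf K].

(* A set S of points of PG(2, q^2) whose only infinite point, if any, is Yinf,
   regarded as a set of points of the projective closure of A'. *)
Definition regard (eps b : K) (S : {set {vspace 'rV[K]_3}}) :
    {set (K * K) + {set {set K * K}}} :=
  [set inl p | p : K * K & hpt 1 p.1 p.2 \in S]
  :|: [set c | (c == vertical_infinity eps b) && (Yinf K \in S)].

End Unitals.

(* Main.v *)
Require Import Defs.
From mathcomp Require Import all_boot all_algebra all_field.
From mathcomp Require Import ring zify.

Set Implicit Arguments.
Unset Strict Implicit.
Unset Printing Implicit Defensive.

Import GRing.Theory.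
Local Open Scope ring_scope.

(** Write [T z = z ^+ q + z] for the trace of GF(q^2) over GF(q).  Both
   [U_b b] and [U_eps eps] consist of [Yinf] and the affine points
   [(x, u x + r)] with [r] in GF(q), that is the [(x, y)] with
   [T y = T (u x)], where [u x] is [b * x ^+ q.+1] or [f x * eps].  The
   coordinate change [eta = y + f xi * eps + b * xi ^+ q.+1] exchanges the two
   functions [u] because the characteristic is 2, so an identification of the
   closure of the new plane sends [U_b b] to [U_eps eps] as soon as it has the
   prescribed values on the affine points and at [Yinf] ([identified_U_b]).
   Such an identification exists: it sends the parallel class of the curves
   with slope [m] to the infinite point [(0, 1, m)]
   ([ident_identification]).

   Both unital properties follow from one criterion ([graph_unital]).  The
   line [y = m x + d] meets such a set in the points whose abscissa satisfies
   [T (u x) = T (m x) + T d].  In both cases a bijection of GF(q^2) absorbs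
   [T (m x)] into [T (u x)], up to a constant, so only the fibres of
   [F = T \o u] must be counted.  Now [F] vanishes only at 0 and there are
   scalings that multiply its values by an arbitrary nonzero element of GF(q);
   hence the nonzero fibres all have (q^2 - 1) / (q - 1) = q + 1 elements
   ([card_fibre]).  For [u x = b * x ^+ q.+1], [F] is a multiple of the norm,
   the bijections are translations and the scalings are multiplications by
   elements of GF(q).  For [u x = f x * eps], [F] is [f], in the coordinates of
   [x] in the basis [1], [eps] it is the equation of the Tits ovoid, and the
   bijections and scalings come from the stabilizer of a point in the Suzuki
   group ([tits_translate], [tits_scale]).

   The set [U_b b] is given by the Hermitian equation
   [T y + T b * x ^+ q.+1 = 0] ([U_b_classical]).  If [U_eps eps] were
   Hermitian, the equation would express [f] by a quadratic form over GF(q) in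
   the two coordinates of [x]; restricted to the multiples of [eps] by elements
   of GF(q), it would be a nonzero polynomial equation of degree
   [2 ^ (e.+1)./2 < q] with [q] roots ([U_eps_not_classical]). *)

(** * Points and lines of the projective plane *)

Section Geometry.

Variable K : finFieldType.

(** The coordinate vector of [hpt a b c]. *)
Definition vec3 (a b c : K) : 'rV[K]_3 := \row_(i < 3) [:: a; b; c]`_i.

Lemma vec3_eta (v : 'rV[K]_3) : v = vec3 (v 0 0) (v 0 1) (v 0 2).
Proof.
apply/rowP => i; rewrite !mxE; case: i => [[|[|[|//]]]] h /=;
  by congr (v _ _); apply: val_inj.
Qed.

Lemma vec3_inj a b c a' b' c' :
  vec3 a b c = vec3 a' b' c' -> [/\ a = a', b = b' & c = c'].
Proof.
move=> /rowP h; move: (h 0) (h 1) (h 2).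
by rewrite !mxE /= => -> -> ->.
Qed.

Lemma scale_vec3 k a b c : k *: vec3 a b c = vec3 (k * a) (k * b) (k * c).
Proof. by rewrite [LHS]vec3_eta !mxE. Qed.

Lemma vec3_eq0 a b c : (vec3 a b c == 0) = [&& a == 0, b == 0 & c == 0].
Proof.
have -> : 0 = vec3 0 0 0 by rewrite [LHS]vec3_eta !mxE.
by apply/eqP/and3P => [/vec3_inj[-> -> ->]|[/eqP -> /eqP -> /eqP ->]].
Qed.

Lemma vline_eqP (v w : 'rV[K]_3) :
  w != 0 -> reflect (exists2 k, k != 0 & v = k *: w) (<[v]> == <[w]>)%VS.
Proof.
move=> w0; apply: (iffP eqP) => [vw|[k k0 ->]].
  have /vlineP[k vk] : v \in <[w]>%VS by rewrite -vw memv_line.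
  exists k => //; apply: contraNneq w0 => k0; move: vw.
  by rewrite vk k0 scale0r => vw; rewrite -memv0 vw memv_line.
apply/eqP; rewrite eqEsubv; apply/andP; split; apply/vlineP.
  by exists k.
by exists k^-1; rewrite scalerA mulVf // scale1r.
Qed.

Lemma hpt_inj (x y x' y' : K) : hpt 1 x y = hpt 1 x' y' -> x = x' /\ y = y'.
Proof.
move=> /eqP/vline_eqP; rewrite vec3_eq0 oner_eq0 => /(_ isT)[k k0].
by rewrite scale_vec3 => /vec3_inj[]; rewrite mulr1 => <-; rewrite !mul1r.
Qed.

Lemma hpt01_inj (m m' : K) : hpt 0 1 m = hpt 0 1 m' -> m = m'.
Proof.
move=> /eqP/vline_eqP; rewrite vec3_eq0 oner_eq0 andbF => /(_ isT)[k k0].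
by rewrite scale_vec3 => /vec3_inj[_]; rewrite mulr1 => <-; rewrite !mul1r.
Qed.

Lemma hpt_neq01 (x y m : K) : hpt 1 x y != hpt 0 1 m.
Proof.
apply/eqP => /eqP/vline_eqP; rewrite vec3_eq0 oner_eq0 andbF => /(_ isT)[k _].
by rewrite scale_vec3 => /vec3_inj[/eqP]; rewrite mulr0 oner_eq0.
Qed.

Lemma hpt_neqY (x y : K) : hpt 1 x y != Yinf K.
Proof.
apply/eqP => /eqP/vline_eqP; rewrite vec3_eq0 oner_eq0 !andbF => /(_ isT)[k _].
by rewrite scale_vec3 => /vec3_inj[/eqP]; rewrite mulr0 oner_eq0.
Qed.

Lemma hpt01_neqY (m : K) : hpt 0 1 m != Yinf K.
Proof.
apply/eqP => /eqP/vline_eqP; rewrite vec3_eq0 oner_eq0 !andbF => /(_ isT)[k _].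
by rewrite scale_vec3 => /vec3_inj[_ /eqP]; rewrite mulr0 oner_eq0.
Qed.

Lemma hpt_pg (a b c : K) : ~~ [&& a == 0, b == 0 & c == 0] ->
  hpt a b c \in pg_points K.
Proof. by rewrite -vec3_eq0 inE dim_vline => ->. Qed.

Lemma dim1_vline (P : {vspace 'rV[K]_3}) :
  P \in pg_points K -> exists2 v, v != 0 & P = <[v]>%VS.
Proof.
rewrite inE => /eqP P1; exists (vpick P).
  by rewrite vpick0 -dimv_eq0 P1.
apply/eqP; rewrite eq_sym eqEdim -memvE memv_pick P1 dim_vline.
by rewrite vpick0 -dimv_eq0 P1.
Qed.

(** The points of the plane, by normalized coordinates: the affine points, the
   infinite points of the lines of slope [m], and that of the vertical lines. *)
Variant pg_point_spec : {vspace 'rV[K]_3} -> Prop :=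
| PgAffine x y : pg_point_spec (hpt 1 x y)
| PgSlope m : pg_point_spec (hpt 0 1 m)
| PgVertical : pg_point_spec (Yinf K).

Lemma pg_pointP P : P \in pg_points K -> pg_point_spec P.
Proof.
move=> /dim1_vline[v v0 ->]; move: v0; rewrite (vec3_eta v).
move: (v 0 0) (v 0 1) (v 0 2) => a b c; rewrite vec3_eq0.
have scaled (k a' b' c' : K) : k != 0 -> vec3 a' b' c' != 0 ->
    <[vec3 (k * a')%R (k * b')%R (k * c')%R]>%VS = hpt a' b' c'.
  by move=> k0 h; apply/eqP/vline_eqP => //; exists k; rewrite ?scale_vec3.
case: (eqVneq a 0) => [-> /=|a0 _]; last first.
  have := scaled a 1 (b / a) (c / a) a0; rewrite vec3_eq0 oner_eq0 => /(_ isT).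
  by rewrite mulr1 !(mulrC a) !divfK // => ->; constructor.
case: (eqVneq b 0) => [-> /= c0|b0 _]; last first.
  have := scaled b 0 1 (c / b) b0; rewrite vec3_eq0 oner_eq0 andbF => /(_ isT).
  by rewrite mulr1 mulr0 !(mulrC b) !divfK // => ->; constructor.
have := scaled c 0 0 1 c0; rewrite vec3_eq0 oner_eq0 !andbF => /(_ isT).
by rewrite mulr1 mulr0 => ->; constructor.
Qed.

(** The kernel of a linear form, the form being given by its coefficients. *)
Definition dual_plane (a : 'rV[K]_3) : {vspace 'rV[K]_3} :=
  lker (linfun (mulmxr a^T)).

(** The points of the projective line with dual coordinates [a]. *)
Definition locus (a : 'rV[K]_3) : {set {vspace 'rV[K]_3}} :=
  [set P in pg_points K | (P <= dual_plane a)%VS].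

Lemma mem_dual (a v : 'rV[K]_3) : (v \in dual_plane a) = (v *m a^T == 0).
Proof. by rewrite memv_ker lfunE. Qed.

Lemma dual_vec3 (a0 a1 a2 x y z : K) :
  (hpt x y z <= dual_plane (vec3 a0 a1 a2))%VS
    = (x * a0 + y * a1 + z * a2 == 0).
Proof.
rewrite -memvE mem_dual; apply/eqP/eqP => [/matrixP/(_ 0 0)|h].
  by rewrite !mxE !big_ord_recr big_ord0 /= !mxE /= add0r.
apply/matrixP => i j; rewrite !ord1 !mxE !big_ord_recr big_ord0 /= !mxE /=.
by rewrite add0r.
Qed.

Lemma dim_dual_plane a : a != 0 -> \dim (dual_plane a) = 2%N.
Proof.
move=> a0; pose g : 'Hom('rV[K]_3, 'M[K]_1) := linfun (mulmxr a^T).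
have := limg_ker_dim g fullv; rewrite capfv dimvf -[lker g]/(dual_plane a).
have img_le1 : (\dim (limg g) <= 1)%N.
  by apply: leq_trans (dimvS (subvf _)) _; rewrite dimvf.
have img_gt0 : (0 < \dim (limg g))%N.
  rewrite lt0n dimv_eq0; apply: contraNneq a0 => img0.
  apply/eqP; apply: trmx_inj; apply/row_matrixP => i.
  rewrite trmx0 row0 rowE; apply/eqP; rewrite -memv0 -img0.
  have -> : delta_mx 0 i *m a^T = g (delta_mx 0 i) by rewrite lfunE.
  exact: memv_img (memvf _).
move: (\dim (limg g)) img_le1 img_gt0 => [|[|//]] // _ _.
by rewrite addn1 => -[].
Qed.

(** Two linear equations in three unknowns have a nonzero solution, so a plane
   spanned by two vectors is the kernel of a nonzero form. *)
Lemma dual_planeP (L : {vspace 'rV[K]_3}) :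
  \dim L = 2%N -> exists2 a, a != 0 & L = dual_plane a.
Proof.
move=> L2; pose A : 'M[K]_(2, 3) := \matrix_(i < 2) (vbasis L)`_i.
have : kermx A^T != 0.
  rewrite kermx_eq0 /row_free; apply/negP => /eqP h.
  by have := rank_leq_col A^T; rewrite h.
case/rowV0Pn => a /sub_kermxP aA a0; exists a => //.
apply/eqP; rewrite eqEdim dim_dual_plane // L2 leqnn andbT.
rewrite -{1}(span_basis (vbasisP L)); apply/span_subvP => v.
case/(nthP 0) => i; rewrite size_tuple => iL <-; rewrite mem_dual.
have i2 : (i < 2)%N by rewrite -L2.
have -> : (vbasis L)`_i = row (Ordinal i2) A by rewrite rowK.
by rewrite -row_mul -[A]trmxK -trmx_mul aA trmx0 row0.
Qed.

Lemma pg_linesP l :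
  reflect (exists2 a, a != 0 & l = locus a) (l \in pg_lines K).
Proof.
apply: (iffP imsetP) => [[L + ->]|[a a0 ->]].
  by rewrite inE => /eqP/dual_planeP[a a0 ->]; exists a.
by exists (dual_plane a); rewrite ?inE ?dim_dual_plane.
Qed.

(** The line at infinity, the line [x = k] and the line [y = m x + d] of
   PG(2, K), each with its points in normalized coordinates. *)
Definition line_inf : {set {vspace 'rV[K]_3}} :=
  Yinf K |: [set hpt 0 1 m | m : K].
Definition line_vert (k : K) : {set {vspace 'rV[K]_3}} :=
  Yinf K |: [set hpt 1 k y | y : K].
Definition line_slope (m d : K) : {set {vspace 'rV[K]_3}} :=
  hpt 0 1 m |: [set hpt 1 x (m * x + d) | x : K].

Lemma in_line_inf_aff x y : (hpt 1 x y \in line_inf) = false.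
Proof.
rewrite !inE (negbTE (hpt_neqY _ _)); apply/imsetP => -[m _ /eqP].
by rewrite (negbTE (hpt_neq01 _ _ _)).
Qed.

Lemma in_line_inf_slope m : hpt 0 1 m \in line_inf.
Proof. by rewrite !inE imset_f ?orbT. Qed.

Lemma in_line_inf_Y : Yinf K \in line_inf.
Proof. by rewrite !inE eqxx. Qed.

Lemma in_line_vert_aff k x y : (hpt 1 x y \in line_vert k) = (x == k).
Proof.
rewrite !inE (negbTE (hpt_neqY _ _)); apply/imsetP/eqP => [[y' _]|->].
  by case/hpt_inj.
by exists y.
Qed.

Lemma in_line_vert_slope k m : (hpt 0 1 m \in line_vert k) = false.
Proof.
rewrite !inE (negbTE (hpt01_neqY _)); apply/imsetP => -[y _ /esym/eqP].
by rewrite (negbTE (hpt_neq01 _ _ _)).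
Qed.

Lemma in_line_vert_Y k : Yinf K \in line_vert k.
Proof. by rewrite !inE eqxx. Qed.

Lemma in_line_slope_aff m d x y :
  (hpt 1 x y \in line_slope m d) = (y == m * x + d).
Proof.
rewrite !inE (negbTE (hpt_neq01 _ _ _)); apply/imsetP/eqP => [[x' _]|->].
  by case/hpt_inj => -> ->.
by exists x.
Qed.

Lemma in_line_slope_slope m d m' : (hpt 0 1 m' \in line_slope m d) = (m' == m).
Proof.
rewrite !inE orbC; case: imsetP => [[x _ /esym/eqP]|_].
  by rewrite (negbTE (hpt_neq01 _ _ _)).
by apply/eqP/eqP => [/hpt01_inj|->].
Qed.

Lemma in_line_slope_Y m d : (Yinf K \in line_slope m d) = false.
Proof.
rewrite !inE eq_sym (negbTE (hpt01_neqY _)); apply/imsetP => -[y _ /esym/eqP].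
by rewrite (negbTE (hpt_neqY _ _)).
Qed.

(** Membership of the normalized points in the normalized lines. *)
Definition in_lines :=
  (in_line_inf_aff, in_line_inf_slope, in_line_inf_Y, in_line_vert_aff,
   in_line_vert_slope, in_line_vert_Y, in_line_slope_aff, in_line_slope_slope,
   in_line_slope_Y).

Lemma line_inf_pg : line_inf \subset pg_points K.
Proof.
apply/subsetP => P; rewrite !inE => /orP[/eqP ->|/imsetP[m _ ->]];
  by rewrite dim_vline vec3_eq0 oner_eq0 ?andbF.
Qed.

Lemma line_vert_pg k : line_vert k \subset pg_points K.
Proof.
apply/subsetP => P; rewrite !inE => /orP[/eqP ->|/imsetP[m _ ->]];
  by rewrite dim_vline vec3_eq0 oner_eq0 ?andbF.
Qed.

Lemma line_slope_pg m d : line_slope m d \subset pg_points K.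
Proof.
apply/subsetP => P; rewrite !inE => /orP[/eqP ->|/imsetP[x _ ->]];
  by rewrite dim_vline vec3_eq0 oner_eq0 ?andbF.
Qed.

(** Sets of points are compared on the normalized coordinate vectors. *)
Lemma eq_pg_sets (A B : {set {vspace 'rV[K]_3}}) :
  A \subset pg_points K -> B \subset pg_points K ->
  (forall x y, (hpt 1 x y \in A) = (hpt 1 x y \in B)) ->
  (forall m, (hpt 0 1 m \in A) = (hpt 0 1 m \in B)) ->
  (Yinf K \in A) = (Yinf K \in B) -> A = B.
Proof.
move=> Apg Bpg hA hS hY; apply/setP => P.
have [/pg_pointP[]//|Pn] := boolP (P \in pg_points K).
by rewrite (contraNF (subsetP Apg P) Pn) (contraNF (subsetP Bpg P) Pn).
Qed.

Lemma locus_pg a : locus a \subset pg_points K.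
Proof. by apply/subsetP => P; rewrite inE => /andP[]. Qed.

Lemma in_locus a0 a1 a2 x y z : ~~ [&& x == 0, y == 0 & z == 0] ->
  (hpt x y z \in locus (vec3 a0 a1 a2)) = (x * a0 + y * a1 + z * a2 == 0).
Proof. by move=> h; rewrite inE hpt_pg // dual_vec3. Qed.

Lemma locus_slope a0 a1 a2 : a2 != 0 ->
  locus (vec3 a0 a1 a2) = line_slope (- a1 / a2) (- a0 / a2).
Proof.
move=> a20; apply: (eq_pg_sets (locus_pg _) (line_slope_pg _ _)) => [x y|m|];
  rewrite in_locus ?oner_eq0 ?andbF // in_lines.
- rewrite -[RHS]subr_eq0 -[RHS](mulIr_eq0 _ (mulIf a20)); congr (_ == 0); field.
  exact: a20.
- rewrite -[RHS]subr_eq0 -[RHS](mulIr_eq0 _ (mulIf a20)); congr (_ == 0); field.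
  exact: a20.
- by rewrite !mul0r !add0r mul1r; apply: negbTE.
Qed.

Lemma locus_vert a0 a1 : a1 != 0 ->
  locus (vec3 a0 a1 0) = line_vert (- a0 / a1).
Proof.
move=> a10; apply: (eq_pg_sets (locus_pg _) (line_vert_pg _)) => [x y|m|];
  rewrite in_locus ?oner_eq0 ?andbF // in_lines.
- rewrite -[RHS]subr_eq0 -[RHS](mulIr_eq0 _ (mulIf a10)); congr (_ == 0); field.
  exact: a10.
- by rewrite !mul0r !mulr0 !add0r addr0 mul1r; apply: negbTE.
- by rewrite !mul0r !mulr0 !add0r eqxx.
Qed.

Lemma locus_inf a0 : a0 != 0 -> locus (vec3 a0 0 0) = line_inf.
Proof.
move=> a00; apply: (eq_pg_sets (locus_pg _) line_inf_pg) => [x y|m|];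
  rewrite in_locus ?oner_eq0 ?andbF // in_lines.
- by rewrite !mulr0 !addr0 mul1r; apply: negbTE.
- by rewrite !mul0r !mulr0 !add0r eqxx.
- by rewrite !mul0r !mulr0 !add0r eqxx.
Qed.

(** The lines of the plane, by normalized equations. *)
Variant pg_line_spec : {set {vspace 'rV[K]_3}} -> Prop :=
| PgLineInf : pg_line_spec line_inf
| PgLineVert k : pg_line_spec (line_vert k)
| PgLineSlope m d : pg_line_spec (line_slope m d).

Lemma pg_lineP l : l \in pg_lines K -> pg_line_spec l.
Proof.
case/pg_linesP => a; rewrite (vec3_eta a).
move: (a 0 0) (a 0 1) (a 0 2) => a0 a1 a2; rewrite vec3_eq0 => + ->.
case: (eqVneq a2 0) => [->|a20 _]; last by rewrite locus_slope //; constructor.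
case: (eqVneq a1 0) => [->|a10 _]; last by rewrite locus_vert //; constructor.
by rewrite !andbT => a00; rewrite locus_inf //; constructor.
Qed.

Lemma line_inf_in : line_inf \in pg_lines K.
Proof.
apply/pg_linesP; exists (vec3 1 0 0); first by rewrite vec3_eq0 oner_eq0.
by rewrite locus_inf // oner_eq0.
Qed.

Lemma line_vert_in k : line_vert k \in pg_lines K.
Proof.
apply/pg_linesP; exists (vec3 (- k) 1 0).
  by rewrite vec3_eq0 oner_eq0 andbF.
by rewrite locus_vert ?oner_eq0 // opprK divr1.
Qed.

Lemma line_slope_in m d : line_slope m d \in pg_lines K.
Proof.
apply/pg_linesP; exists (vec3 (- d) (- m) 1).
  by rewrite vec3_eq0 oner_eq0 !andbF.
by rewrite locus_slope ?oner_eq0 // !opprK !divr1.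
Qed.

End Geometry.
(** * GF(q) inside GF(q^2) *)

Section Field.

Variables (e : nat) (K : finFieldType).
Hypothesis cardK : #|K| = ((2 ^ e) ^ 2)%N.

Let q := (2 ^ e)%N.

(** The trace of GF(q^2) over GF(q). *)
Definition trq (z : K) : K := z ^+ (2 ^ e) + z.

Lemma GFqE (z : K) : (z \in GFq e K) = (z ^+ q == z).
Proof. by rewrite inE. Qed.

Lemma GFqP (z : K) : reflect (z ^+ q = z) (z \in GFq e K).
Proof. by rewrite GFqE; apply: eqP. Qed.

Lemma q_gt0 : (0 < q)%N.
Proof. by rewrite expn_gt0. Qed.

Lemma pchar2K : 2 \in [pchar K].
Proof. by apply: (card_finPcharP (n := (e * 2)%N)); rewrite // cardK expnM. Qed.

Lemma two_eq0 : 2%:R = 0 :> K.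
Proof. exact: pcharf0 pchar2K. Qed.

(** Identities that hold in characteristic 2 are identities modulo 2. *)
Lemma eq_mod2 (x y z : K) : x = y + 2%:R * z -> x = y.
Proof. by rewrite two_eq0 mul0r addr0. Qed.

Lemma oppK (x : K) : - x = x.
Proof. by rewrite (oppr_pchar2 pchar2K). Qed.

Lemma addKK (x : K) : x + x = 0.
Proof. by rewrite -{1}(oppK x) addNr. Qed.

Lemma addr_eq0K (x y : K) : (x + y == 0) = (x == y).
Proof. by rewrite -{2}(oppK y) -addr_eq0. Qed.

Lemma exp2nD n (x y : K) : (x + y) ^+ (2 ^ n) = x ^+ (2 ^ n) + y ^+ (2 ^ n).
Proof.
apply: exprDn_pchar; apply/andP; split; first by rewrite expn_gt0.
apply/allP => p; rewrite mem_primes => /and3P[pp _]; rewrite Euclid_dvdX //.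
by case/andP=> + _; rewrite dvdn_prime2 // => /eqP ->; exact: pchar2K.
Qed.

Lemma qD (x y : K) : (x + y) ^+ q = x ^+ q + y ^+ q.
Proof. exact: exp2nD. Qed.

Lemma qM (x y : K) : (x * y) ^+ q = x ^+ q * y ^+ q.
Proof. exact: exprMn. Qed.

Lemma qq (x : K) : (x ^+ q) ^+ q = x.
Proof. by rewrite -exprM mulnn -cardK expf_card. Qed.

Lemma GFq0 : 0 \in GFq e K.
Proof. by apply/GFqP; rewrite expr0n gtn_eqF ?q_gt0. Qed.

Lemma GFq1 : 1 \in GFq e K.
Proof. by apply/GFqP; rewrite expr1n. Qed.

Lemma GFqD x y : x \in GFq e K -> y \in GFq e K -> x + y \in GFq e K.
Proof. by move=> /GFqP hx /GFqP hy; apply/GFqP; rewrite qD hx hy. Qed.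

Lemma GFqM x y : x \in GFq e K -> y \in GFq e K -> x * y \in GFq e K.
Proof. by move=> /GFqP hx /GFqP hy; apply/GFqP; rewrite qM hx hy. Qed.

Lemma GFqV x : x \in GFq e K -> x^-1 \in GFq e K.
Proof. by move=> /GFqP hx; apply/GFqP; rewrite exprVn hx. Qed.

Lemma GFqX x n : x \in GFq e K -> x ^+ n \in GFq e K.
Proof. by move=> /GFqP hx; apply/GFqP; rewrite exprAC hx. Qed.

Lemma trq_GFq z : trq z \in GFq e K.
Proof. by apply/GFqP; rewrite /trq qD qq addrC. Qed.

Lemma trqD x y : trq (x + y) = trq x + trq y.
Proof. by rewrite /trq qD; ring. Qed.

Lemma trqMl c x : c \in GFq e K -> trq (c * x) = c * trq x.
Proof. by move=> /GFqP hc; rewrite /trq -/q qM hc; ring. Qed.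

Lemma trq_eq0 z : (trq z == 0) = (z \in GFq e K).
Proof. by rewrite addr_eq0K GFqE. Qed.

Lemma trq0 : trq 0 = 0.
Proof. by apply/eqP; rewrite trq_eq0 GFq0. Qed.

Lemma norm_GFq x : x ^+ q.+1 \in GFq e K.
Proof. by apply/GFqP; rewrite !exprS qM qq mulrC. Qed.

Lemma card_roots_le (S : {set K}) (p : {poly K}) :
  p != 0 -> (forall z, z \in S -> root p z) -> (#|S| < size p)%N.
Proof.
move=> p0 rS; rewrite cardE; apply: max_poly_roots => //; last exact: enum_uniq.
by apply/allP => z; rewrite mem_enum; apply: rS.
Qed.

Lemma sqr_inj : injective (fun x : K => x ^+ 2).
Proof.
move=> x y /= h; apply/eqP; rewrite -addr_eq0K -sqrf_eq0 -(expn1 2) exp2nD.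
by rewrite expn1 h addKK.
Qed.

Section Basis.

Variable eps : K.
Hypothesis epsT : trq eps = 1.

(** [x = coor_s x + coor_t x * eps] with both coordinates in GF(q). *)
Definition coor_t (x : K) : K := trq x.
Definition coor_s (x : K) : K := trq x * eps + x.

Lemma coor_t_GFq x : coor_t x \in GFq e K. Proof. exact: trq_GFq. Qed.

Lemma coor_s_GFq x : coor_s x \in GFq e K.
Proof.
rewrite -trq_eq0 /coor_s trqD trqMl ?trq_GFq // epsT mulr1.
by rewrite addKK.
Qed.

Lemma coorK x : coor_s x + coor_t x * eps = x.
Proof.
by rewrite /coor_s /coor_t; apply: (eq_mod2 (z := trq x * eps)); ring.
Qed.

Lemma coor_tE s t : s \in GFq e K -> t \in GFq e K -> coor_t (s + t * eps) = t.
Proof.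
by rewrite -trq_eq0 /coor_t trqD => /eqP -> ht; rewrite trqMl // epsT; ring.
Qed.

Lemma coor_sE s t : s \in GFq e K -> t \in GFq e K -> coor_s (s + t * eps) = s.
Proof.
move=> hs ht; rewrite /coor_s -/(coor_t _) coor_tE //.
by apply: (eq_mod2 (z := t * eps)); ring.
Qed.

Lemma coor_inj x y : coor_s x = coor_s y -> coor_t x = coor_t y -> x = y.
Proof. by move=> h1 h2; rewrite -(coorK x) h1 h2 coorK. Qed.

Lemma e_gt0 : (0 < e)%N.
Proof.
case: posnP => // e0; have := finNzRing_gt1 K.
by rewrite cardK e0.
Qed.

(** The polynomial X^q - X bounds the cardinality from above; coordinates embed
   the field of order q^2 into the square of GF(q). *)
Lemma card_GFq : #|GFq e K| = q.
Proof.
apply/eqP; rewrite eqn_leq; apply/andP; split.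
  have sz : size ('X^q - 'X : {poly K}) = q.+1.
    rewrite size_polyDl size_polyXn // size_polyN size_polyX ltnS.
    exact: leq_ltn_trans e_gt0 (ltn_expl e _).
  rewrite -ltnS -sz; apply: card_roots_le; first by rewrite -size_poly_eq0 sz.
  by move=> z /GFqP hz; rewrite rootE !hornerE hz subrr.
rewrite -(leq_sqr q) -cardK -mulnn -cardsX -cardsT.
rewrite -(card_imset [set: K] (f := fun x => (coor_s x, coor_t x))).
  apply/subset_leq_card/subsetP => _ /imsetP[x _ ->].
  by rewrite inE /= coor_s_GFq coor_t_GFq.
by move=> x y [h1 h2]; apply: coor_inj.
Qed.

End Basis.

(** * A criterion for unitals *)

Section Counting.

Hypothesis GFq_card : #|GFq e K| = q.

(** Fibre sizes of a function into GF(q) that vanishes only at [0] and whose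
   nonzero values are permuted transitively by bijections of the domain: the
   q^2 - 1 nonzero points share the q - 1 nonzero values equally. *)
Lemma card_fibre (F : K -> K) :
  (forall x, F x \in GFq e K) -> (forall x, (F x == 0) = (x == 0)) ->
  (forall c, c \in GFq e K -> c != 0 ->
     exists2 g : K -> K, injective g & forall x, F (g x) = c * F x) ->
  forall c, c \in GFq e K ->
    #|[set x | F x == c]| = if c == 0 then 1%N else q.+1.
Proof.
move=> F_q F_0 F_sc c cq.
have fibre c' : c' \in GFq e K -> c' != 0 ->
    #|[set x | F x == c']| = #|[set x | F x == 1]|.
  move=> c'q c'0; have [g g_inj gF] := F_sc c' c'q c'0.
  rewrite -(card_preimset _ g_inj); apply: eq_card => x.
  by rewrite !inE gF -[X in _ == X]mulr1 (inj_eq (mulfI c'0)).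
have fibre0 : #|[set x | F x == 0]| = 1%N.
  by rewrite -(cards1 (0 : K)); apply: eq_card => x; rewrite !inE F_0.
case: eqP => [-> //|/eqP c0]; rewrite fibre //.
have: #|K| = (1 + (q - 1) * #|[set x | F x == 1%R]|)%N.
  rewrite -[LHS]sum1_card (partition_big F (mem (GFq e K))) //=.
  rewrite (bigD1 0) ?GFq0 //=. congr (_ + _)%N.
    by rewrite sum1_card -fibre0; apply: eq_card => x; rewrite !inE.
  rewrite (eq_bigr (fun=> #|[set x | F x == 1]|)) ?sum_nat_const; last first.
    move=> c' /andP[c'q c'0]; rewrite -(fibre c' c'q c'0) sum1_card.
    by apply: eq_card => x; rewrite !inE.
  congr (_ * _)%N; rewrite -GFq_card (cardsD1 0 (GFq e K)) GFq0 add1n subn1 /=.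
  by apply: eq_card => x; rewrite -topredE /= !inE andbC.
rewrite cardK -/q; have: (1 < q)%N.
  rewrite -GFq_card (cardsD1 0 (GFq e K)) GFq0 add1n ltnS card_gt0.
  by apply/set0Pn; exists c; rewrite !inE c0 -GFqE.
by nia.
Qed.

End Counting.

Section GraphUnital.

Hypothesis GFq_card : #|GFq e K| = q.
Variable u : K -> K.

(** On every vertical line [x = k], the points whose ordinate differs from
   [u k] by an element of GF(q), and the common infinite point [Yinf] of these
   lines.  Both [U_eps] and [U_b] unfold to sets of this form. *)
Definition graph_set : {set {vspace 'rV[K]_3}} :=
  [set hpt 1 x (u x + r) | x : K, r : K in GFq e K] :|: [set Yinf K].

Lemma in_graph_aff x y : (hpt 1 x y \in graph_set) = (trq y == trq (u x)).
Proof.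
rewrite !inE (negbTE (hpt_neqY _ _)) orbF.
rewrite -addr_eq0K -trqD trq_eq0; apply/imset2P/idP => [[x' r _ rq]|yq].
  case/hpt_inj => -> ->; rewrite (_ : _ + _ = r) //.
  by apply: (eq_mod2 (z := u x')); ring.
exists x (y + u x) => //; congr hpt.
by apply: (eq_mod2 (z := - u x)); ring.
Qed.

Lemma in_graph_slope m : (hpt 0 1 m \in graph_set) = false.
Proof.
rewrite !inE (negbTE (hpt01_neqY _)) orbF; apply/imset2P.
case=> x r _ _ /esym/eqP.
by rewrite (negbTE (hpt_neq01 _ _ _)).
Qed.

Lemma in_graph_Y : Yinf K \in graph_set.
Proof. by rewrite !inE eqxx orbT. Qed.

Lemma graph_set_pg : graph_set \subset pg_points K.
Proof.
apply/subsetP => P; rewrite !inE => /orP[/imset2P[x r _ _ ->]|/eqP ->];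
  by rewrite dim_vline vec3_eq0 oner_eq0 ?andbF.
Qed.

Lemma card_graph_set : #|graph_set| = (q ^ 3 + 1)%N.
Proof.
rewrite /graph_set setUC cardsU1 addnC.
case: imset2P => [[x r _ _ /esym/eqP]|_].
  by rewrite (negbTE (hpt_neqY _ _)).
have -> : [set hpt 1 x (u x + r) | x : K, r : K in GFq e K]
    = [set hpt 1 p.1 (u p.1 + p.2) | p in setX [set: K] (GFq e K)].
  apply/setP => P; apply/imset2P/imsetP => [[x r _ rq ->]|[[x r]]].
    by exists (x, r); rewrite // inE in_setT.
  by rewrite inE /= => /andP[_ rq] ->; exists x r.
rewrite card_in_imset.
  by rewrite cardsX cardsT cardK GFq_card -expnSr addn1.
by move=> [x r] [x' r'] _ _ /= /hpt_inj[-> /addrI ->].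
Qed.

(** The point of abscissa [x] on the line [y = m x + d] lies in the set when
   [trq (m * x + d) = trq (u x)], which by the third hypothesis means
   [trq (u (g x)) = trq d + k]: the intersection has the size of a fibre of
   [trq \o u], and the first two hypotheses give that size. *)
Lemma graph_unital :
  (forall x, (trq (u x) == 0) = (x == 0)) ->
  (forall c, c \in GFq e K -> c != 0 ->
     exists2 g : K -> K, injective g &
     forall x, trq (u (g x)) = c * trq (u x)) ->
  (forall m, exists k, exists2 g : K -> K, injective g &
     forall x, trq (u x) + trq (m * x) = trq (u (g x)) + k) ->
  unital e graph_set.
Proof.
move=> u_0 u_sc u_tr; split; [exact: graph_set_pg|exact: card_graph_set|].
move=> l /pg_lineP[|k|m d].
- left; rewrite (_ : _ :&: _ = [set Yinf K]) ?cards1 //; apply/setP => P.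
  rewrite in_setI in_set1; have [->|PY] := eqVneq P.
    by rewrite in_graph_Y in_line_inf_Y.
  rewrite [P \in line_inf K]inE in_set1 (negbTE PY) /=.
  by case: imsetP => [[m _ ->]|_]; rewrite ?andbF // in_graph_slope.
- right.
  have -> : graph_set :&: line_vert k
      = Yinf K |: [set hpt 1 k (u k + r) | r in GFq e K].
    apply: eq_pg_sets => [||x y|m|].
    + exact: subset_trans (subsetIl _ _) graph_set_pg.
    + rewrite subUset sub1set hpt_pg ?oner_eq0 ?andbF //.
      by apply/subsetP => _ /imsetP[r _ ->]; rewrite hpt_pg ?oner_eq0.
    + rewrite in_setI in_line_vert_aff in_graph_aff in_setU in_set1.
      rewrite (negbTE (hpt_neqY _ _)) /=; apply/andP/imsetP => [[yu /eqP xk]|].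
        rewrite xk in yu *; exists (y + u k).
          by rewrite -trq_eq0 trqD addr_eq0K.
        by congr hpt; apply: (eq_mod2 (z := - u k)); ring.
      case=> r rq /hpt_inj[-> ->]; split=> //.
      by move: rq; rewrite trqD -trq_eq0 => /eqP ->; rewrite addr0.
    + rewrite in_setI in_graph_slope andFb in_setU in_set1.
      rewrite (negbTE (hpt01_neqY _)) orFb.
      apply/esym; apply/imsetP => -[r _ /esym/eqP].
      by rewrite (negbTE (hpt_neq01 _ _ _)).
    + by rewrite in_setI in_graph_Y in_line_vert_Y in_setU in_set1 eqxx.
  rewrite cardsU1; case: imsetP => [[r _ /esym/eqP]|_].
    by rewrite (negbTE (hpt_neqY _ _)).
  rewrite card_imset ?GFq_card ?addn1 //.
  by move=> r r' /hpt_inj[_ /addrI].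
have [k [g g_inj gE]] := u_tr m.
have -> : graph_set :&: line_slope m d
    = [set hpt 1 x (m * x + d) | x in [set x | trq (u (g x)) == trq d + k]].
  have key x : (trq (m * x + d) == trq (u x)) = (trq (u (g x)) == trq d + k).
    have -> : trq (u (g x)) = trq (u x) + trq (m * x) + k.
      by rewrite gE -addrA addKK addr0.
    rewrite trqD -[LHS]addr_eq0K -[RHS]addr_eq0K; congr (_ == 0).
    by apply: (eq_mod2 (z := - k)); ring.
  apply: eq_pg_sets => [||x y|m'|].
  - exact: subset_trans (subsetIl _ _) graph_set_pg.
  - by apply/subsetP => _ /imsetP[r _ ->]; rewrite hpt_pg ?oner_eq0.
  - rewrite in_setI in_graph_aff in_line_slope_aff.
    apply/andP/imsetP => [[yu /eqP yE]|[x' + /hpt_inj[-> ->]]].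
      by exists x; rewrite ?yE // inE -key -yE.
    by rewrite inE -key => ->.
  - rewrite in_setI in_graph_slope andFb; apply/esym; apply/imsetP.
    case=> r _ /esym/eqP.
    by rewrite (negbTE (hpt_neq01 _ _ _)).
  - rewrite in_setI in_line_slope_Y andbF; apply/esym; apply/imsetP.
    case=> r _ /esym/eqP.
    by rewrite (negbTE (hpt_neqY _ _)).
rewrite card_imset; last by move=> x x' /hpt_inj[].
have -> : [set x | trq (u (g x)) == trq d + k]
    = g @^-1: [set x | trq (u x) == trq d + k].
  by apply/setP => x; rewrite !inE.
have kq : k \in GFq e K.
  rewrite (_ : k = trq (u 0) + trq (m * 0) + trq (u (g 0))).
    by apply: GFqD (trq_GFq _); apply: GFqD; apply: trq_GFq.
  by rewrite gE; apply: (eq_mod2 (z := - trq (u (g 0)))); ring.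
rewrite card_preimset // (card_fibre GFq_card (F := fun x => trq (u x))) //.
- by case: ifP => _; [left|right; rewrite addn1].
- by move=> x; apply: trq_GFq.
- by apply: GFqD (trq_GFq _) kq.
Qed.

End GraphUnital.

(** * The classical unital *)

Section HermitianCurve.

Variable H : 'M[K]_3.

(** The value at [(x, y, z)] of the Hermitian form with matrix [H]. *)
Definition herm_form (x y z : K) : K :=
  (x * H 0 0 + y * H 1 0 + z * H 2 0) * x ^+ q
  + (x * H 0 1 + y * H 1 1 + z * H 2 1) * y ^+ q
  + (x * H 0 2 + y * H 1 2 + z * H 2 2) * z ^+ q.

Lemma herm_formE x y z :
  (vec3 x y z *m H *m (map_mx (fun c => c ^+ q) (vec3 x y z))^T == 0)
    = (herm_form x y z == 0).
Proof.
have ordE : (widen_ord (leqnSn 2) (widen_ord (leqnSn 1) ord_max) = 0 :> 'I_3)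
  * (widen_ord (leqnSn 2) ord_max = 1 :> 'I_3) * (ord_max = 2 :> 'I_3).
  by do !split; apply: val_inj.
have entry : (vec3 x y z *m H *m (map_mx (fun c => c ^+ q) (vec3 x y z))^T) 0 0
    = herm_form x y z.
  by rewrite !mxE !big_ord_recr big_ord0 !mxE !big_ord_recr !big_ord0 /= !mxE
     /= !ordE !add0r.
apply/eqP/eqP => [h|h]; first by rewrite -entry h mxE.
by apply/matrixP => i j; rewrite !ord1 entry h mxE.
Qed.

Lemma in_hermitian x y z : ~~ [&& x == 0, y == 0 & z == 0] ->
  (hpt x y z \in hermitian_curve e H) = (herm_form x y z == 0).
Proof.
rewrite -vec3_eq0 => v0; rewrite -herm_formE.
apply/imsetP/idP => [[w + /eqP/vline_eqP]|h]; last first.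
  by exists (vec3 x y z); rewrite // inE v0.
rewrite inE => /andP[w0 /eqP hw] /(_ w0)[k k0 vE].
rewrite (vE : vec3 x y z = _) -!scalemxAl.
rewrite (_ : map_mx _ _ = k ^+ q *: map_mx (fun c => c ^+ q) w).
  by rewrite linearZ -scalemxAr hw !scaler0.
by apply/matrixP => i j; rewrite !mxE exprMn.
Qed.

Lemma hermitian_pg : hermitian_curve e H \subset pg_points K.
Proof.
apply/subsetP => _ /imsetP[v + ->]; rewrite inE => /andP[v0 _].
by rewrite inE dim_vline v0.
Qed.

End HermitianCurve.

Section ClassicalUnital.

Hypothesis GFq_card : #|GFq e K| = q.
Variable b : K.
Hypothesis b_notin : b \notin GFq e K.

Lemma trq_b_neq0 : trq b != 0.
Proof. by rewrite trq_eq0. Qed.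

Lemma trq_b_norm x : trq (b * x ^+ q.+1) = trq b * x ^+ q.+1.
Proof. by rewrite mulrC trqMl ?norm_GFq // mulrC. Qed.

Lemma U_b_unital : unital e (U_b e b).
Proof.
apply: (@graph_unital GFq_card (fun x => b * x ^+ q.+1)) => [x|c cq c0|m].
- by rewrite trq_b_norm mulf_eq0 (negbTE trq_b_neq0) expf_eq0.
(* A square root of [c] in GF(q): the norm of an element is its square there. *)
- pose r := c ^+ (2 ^ e.-1).
  have r2 : r ^+ 2 = c.
    by rewrite -exprM -expnSr (prednK e_gt0); apply/GFqP.
  have r0 : r != 0 by rewrite -sqrf_eq0 r2.
  exists (fun x => r * x) => [|x]; first exact: mulfI.
  rewrite !trq_b_norm exprMn [r ^+ _]exprS (GFqP _ (GFqX _ cq)) -expr2 r2; ring.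
(* With this [a], the polarization of the norm between [x] and [a] is
   [trq (m / trq b * x)]. *)
pose a := (m / trq b) ^+ q.
exists (trq b * a ^+ q.+1); exists (fun x => x + a) => [|x]; first exact: addIr.
have -> : trq (m * x) = trq b * trq (m / trq b * x).
  by rewrite -trqMl ?trq_GFq // mulrA mulrCA divff ?trq_b_neq0 // mulr1.
rewrite !trq_b_norm !exprS qD /trq -/q qM /a qq.
set B := b ^+ q + b; set M := m / B.
by apply: (eq_mod2 (z := - B * M ^+ q * M)); ring.
Qed.

Lemma U_b_classical : classical e (U_b e b).
Proof.
(* The matrix of the form [T y + T b * x ^+ q.+1], made homogeneous. *)
pose A (c : K) : 'M[K]_3 :=
  \matrix_(i, j) (nth [::] [:: [:: 0; 0; 1]; [:: 0; c; 0]; [:: 1; 0; 0]] i)`_j.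
have AE (c : K) : (A c 0 0 = 0) * (A c 1 0 = 0) * (A c 2 0 = 1) *
    (A c 0 1 = 0) * (A c 1 1 = c) * (A c 2 1 = 0) *
    (A c 0 2 = 1) * (A c 1 2 = 0) * (A c 2 2 = 0).
  by rewrite !mxE.
have expq0 : (0 : K) ^+ q = 0 by apply/GFqP/GFq0.
exists (A (trq b)); split.
- apply/matrixP => i j; rewrite !mxE.
  case: i j => [[|[|[|//]]] ?] [[|[|[|//]]] ?] /=; rewrite ?expr1n ?expq0 //.
  by rewrite (GFqP _ (trq_GFq b)).
- have AV : A (trq b) *m A (trq b)^-1 = 1%:M.
    apply/matrixP => i j; rewrite !mxE !big_ord_recr big_ord0 /= !mxE /=.
    case: i j => [[|[|[|//]]] ?] [[|[|[|//]]] ?] /=;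
      rewrite ?(mulr0, mul0r, addr0, add0r, mulr1) //.
    by rewrite divff ?trq_b_neq0.
  by case: (mulmx1_unit AV).
apply: eq_pg_sets; first exact: (graph_set_pg (fun x => b * x ^+ q.+1)).
- exact: hermitian_pg.
- move=> x y; rewrite (in_graph_aff (fun x => b * x ^+ q.+1)) trq_b_norm.
  rewrite in_hermitian ?oner_eq0 // /herm_form !AE expr1n -addr_eq0K.
  by congr (_ == 0); rewrite /trq -/q exprS; ring.
- move=> m; rewrite (in_graph_slope (fun x => b * x ^+ q.+1)).
  rewrite in_hermitian ?oner_eq0 ?andbF // /herm_form !AE expr1n expq0.
  rewrite !(mulr0, mul0r, addr0, add0r, mulr1, mul1r).
  by rewrite (negbTE trq_b_neq0).
- rewrite (in_graph_Y (fun x => b * x ^+ q.+1)).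
  rewrite in_hermitian ?oner_eq0 ?andbF // /herm_form !AE expr1n expq0.
  by rewrite !(mulr0, mul0r, addr0, add0r, mulr1, mul1r) eqxx.
Qed.

End ClassicalUnital.

(** * The Buekenhout-Tits unital *)

Section TitsUnital.

Hypothesis e_gt1 : (1 < e)%N.
Hypothesis e_odd : odd e.
Variable eps : K.
Hypothesis eps_BT : BT_parameter e eps.

(** The conjugate of [eps] is the other root [eps + 1] of its equation. *)
Lemma trq_eps : trq eps = 1.
Proof.
case: eps_BT => eps_n [d [dq _ _ epsE]].
have : trq eps * (trq eps + 1) = 0.
  have: (eps ^+ 2 + eps + d) ^+ q + (eps ^+ 2 + eps + d) = 0.
    by rewrite epsE addr0; apply/GFqP/GFq0.
  rewrite !qD (GFqP _ dq) exprAC /trq -/q => h.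
  by rewrite -h; apply: (eq_mod2 (z := eps ^+ q * eps - d)); ring.
move/eqP; rewrite mulf_eq0 trq_eq0 (negbTE eps_n) /= addr_eq0K.
by move/eqP.
Qed.

Let GFq_card : #|GFq e K| = q := card_GFq trq_eps.

Lemma sigmaD (x y : K) : sigma e (x + y) = sigma e x + sigma e y.
Proof. exact: exp2nD. Qed.

Lemma sigmaM (x y : K) : sigma e (x * y) = sigma e x * sigma e y.
Proof. exact: exprMn. Qed.

Lemma sigma_GFq x : x \in GFq e K -> sigma e x \in GFq e K.
Proof. exact: GFqX. Qed.

Lemma sigma_eq0 (x : K) : (sigma e x == 0) = (x == 0).
Proof. by rewrite expf_eq0 expn_gt0. Qed.

(** On GF(q), [sigma] is a square root of the Frobenius automorphism. *)
Lemma sigma_sigma x : x \in GFq e K -> sigma e (sigma e x) = x ^+ 2.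
Proof.
move=> /GFqP xq; rewrite /sigma -exprM -expnD addnn.
have -> : (e.+1)./2.*2 = e.+1 by move: e_odd; lia.
by rewrite expnSr exprM xq.
Qed.

(** The function whose graph over GF(q)^2, completed by one point, is the Tits
   ovoid. *)
Definition tits (s t : K) : K := sigma e s * s ^+ 2 + sigma e t + s * t.

Lemma fE x : f e eps x = tits (coor_s eps x) (coor_t x).
Proof. by []. Qed.

Lemma tits_GFq s t : s \in GFq e K -> t \in GFq e K -> tits s t \in GFq e K.
Proof. by move=> sq tq; rewrite !(GFqD, GFqM, GFqX, sigma_GFq). Qed.

Lemma f_GFq x : f e eps x \in GFq e K.
Proof. by rewrite fE tits_GFq ?coor_t_GFq ?coor_s_GFq ?trq_eps. Qed.

Lemma trq_f_eps x : trq (f e eps x * eps) = f e eps x.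
Proof. by rewrite trqMl ?f_GFq // trq_eps mulr1. Qed.

(** With [s <> 0] the equation scales to [t ^ sigma = t + 1]; applying [sigma]
   gives [t ^ 2 = t], hence [t ^ sigma = t], a contradiction. *)
Lemma tits_eq0 s t : s \in GFq e K -> t \in GFq e K ->
  (tits s t == 0) = (s == 0) && (t == 0).
Proof.
move=> sq tq; have [->|s0] := eqVneq s 0.
  by rewrite /tits expr0n !(mulr0, mul0r, add0r, addr0) sigma_eq0.
apply/negbTE/eqP => h; pose w := t / (sigma e s * s).
have ss0 : sigma e s != 0 by rewrite sigma_eq0.
have tE : t = sigma e s * s * w by rewrite mulrC divfK // mulf_neq0.
have wq : w \in GFq e K by rewrite GFqM ?GFqV ?GFqM ?sigma_GFq.
have hw : sigma e w = w + 1.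
  have : sigma e s * s ^+ 2 * (sigma e w + (w + 1)) = 0.
    rewrite -h /tits tE !sigmaM sigma_sigma //; ring.
  move/eqP; rewrite mulf_eq0 (negbTE (mulf_neq0 ss0 (expf_neq0 2 s0))) /=.
  by rewrite addr_eq0K => /eqP.
have w2 : w * (w - 1) = 0.
  rewrite mulrBr mulr1 -expr2 -sigma_sigma // hw sigmaD hw.
  rewrite [sigma e 1]expr1n; apply: (eq_mod2 (z := 1)); ring.
move: hw; move/eqP: w2; rewrite mulf_eq0 subr_eq0.
case/orP => /eqP ->; rewrite /sigma ?expr1n ?expr0n ?gtn_eqF ?expn_gt0 //;
  move/eqP.
  by rewrite add0r eq_sym oner_eq0.
by rewrite addKK oner_eq0.
Qed.

(** The map [l |-> l ^ (sigma + 2)] permutes GF(q): it is multiplicative, and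
   [l ^ (sigma + 2) = 1] gives [l ^ (2 sigma + 2) = 1] by applying [sigma],
   whence [l ^ 2 = 1]. *)
Lemma sigma2_surj c : c \in GFq e K -> c != 0 ->
  exists l, [/\ l \in GFq e K, l != 0 & sigma e l * l ^+ 2 = c].
Proof.
pose h (l : K) := sigma e l * l ^+ 2.
have h1 l : l \in GFq e K -> h l = 1 -> l = 1.
  move=> lq hl; have l0 : l != 0.
    apply: contra_eq_neq hl => ->.
    by rewrite /h expr0n mulr0 eq_sym oner_eq0.
  (* Compare [h l ^+ 2], of exponent [2 sigma + 4], with [sigma (h l)], of
     exponent [2 sigma + 2]. *)
  have : sigma e (h l) = 1 by rewrite hl [LHS]expr1n.
  rewrite /h expr2 !sigmaM sigma_sigma // => h2.
  have : h l ^+ 2 = l ^+ 2 * (l ^+ 2 * (sigma e l * sigma e l)).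
    by rewrite /h; ring.
  by rewrite hl h2 mulr1 => h3; apply: sqr_inj; rewrite h3.
have h_inj : {in GFq e K &, injective h}.
  move=> l m lq mq hlm; have [m0|m0] := eqVneq m 0.
    move: hlm; rewrite m0 {2}/h expr0n mulr0 => /eqP.
    by rewrite mulf_eq0 sigma_eq0 expf_eq0 /= orbb => /eqP.
  apply: (divIf m0); rewrite divff //; apply: h1; first by rewrite GFqM ?GFqV.
  have hM x y : h (x * y) = h x * h y by rewrite /h sigmaM exprMn; ring.
  by rewrite hM hlm -hM divff // /h /sigma !expr1n mulr1.
have h_im : h @: GFq e K = GFq e K.
  apply/eqP; rewrite eqEcard card_in_imset // leqnn andbT.
  by apply/subsetP => _ /imsetP[l lq ->]; rewrite GFqM ?GFqX ?sigma_GFq.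
rewrite -{1}h_im => /imsetP[l lq ->] hl0; exists l; split=> //.
by apply: contraNneq hl0 => ->; rewrite /h expr0n mulr0.
Qed.

Lemma tits_scale l s t : l \in GFq e K ->
  tits (l * s) (sigma e l * l * t) = sigma e l * l ^+ 2 * tits s t.
Proof. by move=> lq; rewrite /tits !sigmaM sigma_sigma //; ring. Qed.

(** The translations of the Suzuki group: they absorb every linear term. *)
Lemma tits_translate a c s t :
  a \in GFq e K ->
  tits (s + a) (t + c + sigma e a * s)
    = tits s t + tits a c + s * (c + sigma e a * a) + a * t.
Proof.
move=> aq; rewrite /tits !sigmaD !sigmaM sigma_sigma //.
apply: (eq_mod2 (z := sigma e s * s * a + sigma e a * s * a +
  sigma e s * a ^+ 2 + sigma e a * s ^+ 2)); ring.
Qed.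

Lemma U_eps_unital : unital e (U_eps e eps).
Proof.
have sq := coor_s_GFq trq_eps; have tq := coor_t_GFq.
apply: (@graph_unital GFq_card (fun x => f e eps x * eps)) => [x|c cq c0|m].
- rewrite trq_f_eps fE tits_eq0 //; apply/andP/eqP => [[/eqP s0 /eqP t0]|->].
    by rewrite -(coorK eps x) s0 t0 mul0r addr0.
  by rewrite /coor_s /coor_t trq0 mul0r addr0.
- have [l [lq l0 <-]] := sigma2_surj cq c0.
  pose g x := l * coor_s eps x + sigma e l * l * coor_t x * eps.
  have gs x : coor_s eps (g x) = l * coor_s eps x.
    by rewrite coor_sE ?trq_eps // !GFqM ?sigma_GFq.
  have gt x : coor_t (g x) = sigma e l * l * coor_t x.
    by rewrite (coor_tE trq_eps) // !GFqM ?sigma_GFq.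
  have sl0 : sigma e l * l != 0 by rewrite mulf_neq0 ?sigma_eq0.
  exists g => [x y gxy|x]; last by rewrite !trq_f_eps !fE gs gt tits_scale.
  apply: (@coor_inj eps).
    by apply: (mulfI l0); rewrite -!gs gxy.
  by apply: (mulfI sl0); rewrite -!gt gxy.
(* [trq (m * x) = s * trq m + t * a] in the coordinates [s], [t] of [x]; [c] is
   the value for which [tits_translate] produces this linear form. *)
pose a := trq (m * eps); pose c := trq m + sigma e a * a.
have aq : a \in GFq e K by apply: trq_GFq.
have cq : c \in GFq e K.
  by apply: GFqD (trq_GFq _) _; apply: GFqM => //; apply: sigma_GFq.
pose g x := (coor_s eps x + a)
  + (coor_t x + c + sigma e a * coor_s eps x) * eps.
have sgq x : coor_s eps x + a \in GFq e K by exact: GFqD.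
have tgq x : coor_t x + c + sigma e a * coor_s eps x \in GFq e K.
  by apply: GFqD; [exact: GFqD|apply: GFqM => //; exact: sigma_GFq].
have gs x : coor_s eps (g x) = coor_s eps x + a by rewrite coor_sE ?trq_eps.
have gt x : coor_t (g x) = coor_t x + c + sigma e a * coor_s eps x.
  by rewrite (coor_tE trq_eps).
exists (tits a c); exists g => [x y gxy|x].
  have sxy : coor_s eps x = coor_s eps y.
    by apply: (addIr a); rewrite -!gs gxy.
  apply: (@coor_inj eps) => //.
  by have := gt x; rewrite gxy gt sxy => /addIr/addIr.
have -> : trq (m * x) = coor_s eps x * trq m + coor_t x * a.
  by rewrite -!trqMl // -trqD; congr trq; rewrite -{1}(coorK eps x); ring.
rewrite !trq_f_eps !fE gs gt tits_translate // /c.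
by apply: (eq_mod2 (z := - tits a (trq m + sigma e a * a) -
  coor_s eps x * sigma e a * a)); ring.
Qed.

Lemma U_eps_BT : BT_unital e (U_eps e eps).
Proof.
exists eps; split=> //; exists 1%:M; split; first exact: unitmx1.
have id1 (P : {vspace 'rV[K]_3}) : (linfun (mulmxr 1%:M) @: P)%VS = P.
  rewrite (_ : linfun _ = \1%VF) ?lim1g //.
  by apply/lfunP => v; rewrite !lfunE /= mulmx1.
by rewrite (eq_imset _ id1) imset_id.
Qed.

(** A nondegenerate Hermitian form vanishing on the set has few nonzero entries
   and gives [h * f x + trq (c * x ^+ q) + d * x ^+ q.+1 = 0] with [h != 0].
   At [x = t * eps] with [t] in GF(q) this reads
   [h * t ^ sigma + A * t + B * t ^ 2 = 0]. *)
Lemma U_eps_not_classical : ~ classical e (U_eps e eps).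
Proof.
case=> H [H_herm H_unit U_H].
have Hc i j : H j i = (H i j) ^+ q.
  by have := congr1 (fun M : 'M[K]_3 => M i j) H_herm; rewrite !mxE.
have on_H (x y z : K) : ~~ [&& x == 0, y == 0 & z == 0] ->
    hpt x y z \in U_eps e eps -> herm_form H x y z = 0.
  by move=> n0; rewrite U_H in_hermitian // => /eqP.
have expq0 : (0 : K) ^+ q = 0 by apply/GFqP/GFq0.
have H22 : H 2 2 = 0.
  have := on_H 0 0 1; rewrite oner_eq0 !andbF.
  move/(_ isT (in_graph_Y _)); rewrite /herm_form expq0 expr1n.
  by rewrite !(mulr0, mul0r, addr0, add0r, mulr1, mul1r).
have aff x r : r \in GFq e K -> herm_form H 1 x (f e eps x * eps + r) = 0.
  move=> rq; apply: on_H; first by rewrite oner_eq0.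
  rewrite (in_graph_aff (fun x => f e eps x * eps)) trqD.
  by move: rq; rewrite -trq_eq0 => /eqP ->; rewrite addr0.
(* The difference of the equations at [r = 0] and [r = 1]. *)
have step x : H 0 2 + x * H 1 2 + (H 2 0 + H 2 1 * x ^+ q) = 0.
  have := aff x 0 GFq0; have := aff x 1 GFq1.
  rewrite /herm_form H22 !mulr0 !addr0 qD !expr1n; set y := f e eps x * eps.
  move=> h1 h0; rewrite -[RHS]addr0 -{1}h1 -h0.
  by apply: (eq_mod2 (z := - (H 0 0 + x * H 1 0 + y * H 2 0
    + (H 0 1 + x * H 1 1 + y * H 2 1) * x ^+ q
    + (H 0 2 + x * H 1 2) * y ^+ q))); ring.
have H02 : H 0 2 = H 2 0.
  have := step 0; rewrite expq0 !(mulr0, mul0r, addr0).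
  by move/eqP; rewrite addr_eq0K => /eqP.
(* By [step], [trq (H 1 2 * x)] vanishes identically. *)
have H12 : H 1 2 = 0.
  apply/eqP; apply: contraT => h0.
  have := step (eps / H 1 2); rewrite H02 divfK // (Hc 1 2) => h.
  have : trq eps = 0.
    rewrite -[RHS]h /trq -/q exprMn exprVn mulrCA divff ?expf_neq0 // mulr1.
    by apply: (eq_mod2 (z := - H 2 0)); ring.
  by rewrite trq_eps => /eqP; rewrite oner_eq0.
have H21 : H 2 1 = 0 by rewrite (Hc 1 2) H12.
(* Otherwise the last row of [H] is zero. *)
have H20 : H 2 0 != 0.
  apply/eqP => h.
  have : vec3 0 0 1 *m H = 0.
    apply/rowP => j; rewrite !mxE !big_ord_recr big_ord0 /= !mxE /=.
    rewrite !mul0r !add0r mul1r.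
    rewrite (_ : ord_max = 2); last exact: val_inj.
    case: j => [[|[|[|//]]] j3].
    - by rewrite (_ : Ordinal _ = 0) //; apply: val_inj.
    - by rewrite (_ : Ordinal _ = 1) //; apply: val_inj.
    - by rewrite (_ : Ordinal _ = 2) //; apply: val_inj.
  move/(congr1 (mulmx^~ (invmx H))); rewrite mulmxK // mul0mx => /eqP.
  by rewrite vec3_eq0 oner_eq0 !andbF.
have main x : H 2 0 * f e eps x + trq (H 0 1 * x ^+ q) + H 1 1 * x ^+ q.+1
    + H 0 0 = 0.
  have h := aff x 0 GFq0; rewrite -(trq_f_eps x) -[RHS]h.
  rewrite /herm_form H22 H12 H21 H02 (Hc 0 1) addr0 !expr1n.
  by rewrite /trq -/q [(H 0 1 * _) ^+ q]exprMn qq [x ^+ q.+1]exprS; ring.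
have H00 : H 0 0 = 0.
  have f0 : f e eps 0 = 0.
    apply/eqP; rewrite fE tits_eq0 ?(coor_s_GFq trq_eps, coor_t_GFq) //.
    by rewrite /coor_s /coor_t trq0 mul0r addr0 eqxx.
  have := main 0; rewrite f0 expq0 exprS mul0r !mulr0 /trq -/q expq0.
  by rewrite !add0r.
pose A := trq (H 0 1 * eps ^+ q); pose B := H 1 1 * eps ^+ q.+1.
pose Q := (2 ^ (e.+1)./2)%N.
have Q_lt : (Q < q)%N by rewrite ltn_exp2l //; move: e_odd e_gt1; lia.
have Q_gt2 : (2 < Q)%N.
  by rewrite -{1}(expn1 2) ltn_exp2l //; move: e_odd e_gt1; lia.
pose p : {poly K} := H 2 0 *: 'X^Q + (A *: 'X + B *: 'X^2).
have sz : size p = Q.+1.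
  rewrite size_polyDl size_scale ?size_polyXn //.
  apply: leq_ltn_trans (size_polyD _ _) _; rewrite gtn_max.
  apply/andP; split; apply: leq_ltn_trans (size_scale_leq _ _) _.
    by rewrite size_polyX; lia.
  by rewrite size_polyXn; lia.
have : (#|GFq e K| < size p)%N.
  apply: card_roots_le => [|t tq]; first by rewrite -size_poly_eq0 sz.
  have := main (t * eps); rewrite fE H00 addr0.
  have -> : coor_s eps (t * eps) = 0.
    by rewrite -[t * eps]add0r coor_sE ?trq_eps // GFq0.
  have -> : coor_t (t * eps) = t.
    by rewrite -[t * eps]add0r (coor_tE trq_eps) // GFq0.
  rewrite /tits expr0n mulr0 mul0r add0r addr0.
  rewrite !exprMn (GFqP _ tq) [t ^+ q.+1]exprS (GFqP _ tq) mulrCA trqMl //.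
  rewrite rootE !(hornerD, hornerZ, hornerXn, hornerX) -/A /sigma -/Q /B.
  by move=> h; apply/eqP; rewrite -[RHS]h; ring.
by rewrite GFq_card sz ltnS leqNgt Q_lt.
Qed.

End TitsUnital.

(** * The projective closure of the new affine plane *)

Section Identification.

Variables eps b : K.

Let lines := A'_lines e eps b.

(** The difference between the ordinates of a point in the two planes; the
   curve D(m, d) is the graph of [m * x + d + w x]. *)
Let w (x : K) : K := f e eps x * eps + b * x ^+ q.+1.

Lemma in_curveD m d p :
  (p \in curveD e eps b m d) = (p.2 + w p.1 == m * p.1 + d).
Proof.
rewrite inE -[LHS]addr_eq0K -[RHS]addr_eq0K /w -/q; congr (_ == 0).
by ring.
Qed.

Lemma in_vertical (k : K) p : (p \in vertical_line k) = (p.1 == k).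
Proof. by rewrite inE. Qed.

Lemma vertical_in k : vertical_line k \in lines.
Proof. by apply/setUP; left; apply: imset_f. Qed.

Lemma curveD_in m d : curveD e eps b m d \in lines.
Proof. by apply/setUP; right; apply: imset2_f. Qed.

Variant A'_line_spec : {set K * K} -> Prop :=
| A'Vertical k : A'_line_spec (vertical_line k)
| A'Curve m d : A'_line_spec (curveD e eps b m d).

Lemma A'_lineP l : l \in lines -> A'_line_spec l.
Proof.
by case/setUP => [/imsetP[k _ ->]|/imset2P[m d _ _ ->]]; constructor.
Qed.

Lemma vertical_disjoint (k k' : K) :
  (vertical_line k == vertical_line k')
  || [disjoint vertical_line k & vertical_line k'].
Proof.
have [->|kk'] := eqVneq k k'; first by rewrite eqxx.
apply/orP; right; rewrite -setI_eq0; apply/eqP/setP => p.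
by rewrite in_set0 in_setI !in_vertical; apply/andP => -[/eqP ->]; apply/negP.
Qed.

Lemma curve_disjoint m d d' :
  (curveD e eps b m d == curveD e eps b m d')
  || [disjoint curveD e eps b m d & curveD e eps b m d'].
Proof.
have [->|dd'] := eqVneq d d'; first by rewrite eqxx.
apply/orP; right; rewrite -setI_eq0; apply/eqP/setP => p.
rewrite in_set0 in_setI !in_curveD; apply/andP => -[/eqP ->].
by rewrite (inj_eq (addrI _)) (negbTE dd').
Qed.

(** Two lines that are neither equal nor disjoint are not parallel. *)
Lemma not_parallel (l l' : {set K * K}) p p' :
  p \in l -> p \in l' -> p' \in l -> p' \notin l' ->
  (l == l') || [disjoint l & l'] = false.
Proof.
move=> pl pl' p'l p'l'; apply/norP; split.
  by apply: contraNneq p'l' => <-.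
by rewrite -setI_eq0; apply/set0Pn; exists p; rewrite in_setI pl pl'.
Qed.

Lemma point_on_curve m d x : (x, m * x + d + w x) \in curveD e eps b m d.
Proof. by rewrite in_curveD /= -addrA addKK addr0. Qed.

Lemma vertical_curve k m d :
  (vertical_line k == curveD e eps b m d)
  || [disjoint vertical_line k & curveD e eps b m d] = false.
Proof.
apply: (not_parallel (p := (k, m * k + d + w k))
  (p' := (k, m * k + d + w k + 1))); rewrite ?point_on_curve ?in_vertical //=.
rewrite in_curveD /=.
have -> : m * k + d + w k + 1 + w k = m * k + d + 1.
  by apply: (eq_mod2 (z := w k)); ring.
by rewrite -subr_eq0 addrC addKr oner_eq0.
Qed.

Lemma curve_vertical k m d :
  (curveD e eps b m d == vertical_line k)
  || [disjoint curveD e eps b m d & vertical_line k] = false.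
Proof. by rewrite eq_sym disjoint_sym vertical_curve. Qed.

Lemma curve_curve m d m' d' : m != m' ->
  (curveD e eps b m d == curveD e eps b m' d')
  || [disjoint curveD e eps b m d & curveD e eps b m' d'] = false.
Proof.
rewrite -subr_eq0 => mm'; pose x := (d' - d) / (m - m').
have on x' : ((x', m * x' + d + w x') \in curveD e eps b m' d') = (x' == x).
  rewrite in_curveD /= -addrA addKK addr0 -[LHS]subr_eq0 -[RHS]subr_eq0.
  rewrite -[RHS](mulIr_eq0 _ (mulIf mm')) mulrBl divfK //.
  by congr (_ == 0); ring.
apply: (not_parallel (p := (x, m * x + d + w x))
  (p' := (x + 1, m * (x + 1) + d + w (x + 1)))); rewrite ?point_on_curve ?on //.
by rewrite -subr_eq0 addrC addKr oner_eq0.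
Qed.

(** The parallel class of the vertical lines and that of the curves D(m, _). *)
Definition class_vert : {set {set K * K}} := [set vertical_line k | k : K].
Definition class_slope (m : K) : {set {set K * K}} :=
  [set curveD e eps b m d | d : K].

Lemma parallel_vertical k : parallel_class lines (vertical_line k) = class_vert.
Proof.
apply/setP => l; rewrite inE; apply/andP/imsetP => [[/A'_lineP[k' _|m d]]|].
- by exists k'.
- by rewrite vertical_curve.
by case=> k' _ ->; rewrite vertical_in vertical_disjoint.
Qed.

Lemma parallel_curve m d :
  parallel_class lines (curveD e eps b m d) = class_slope m.
Proof.
apply/setP => l; rewrite inE; apply/andP/imsetP => [[/A'_lineP[k|m' d']]|].
- by rewrite curve_vertical.
- by have [<- _|mm'] := eqVneq m m'; [exists d'|rewrite curve_curve].
by case=> d' _ ->; rewrite curveD_in curve_disjoint.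
Qed.

Lemma class_slope_inj : injective class_slope.
Proof.
move=> m m' mm'; apply/eqP; apply: contraT => h.
have := imset_f (curveD e eps b m) (in_setT 0); rewrite -/(class_slope m).
have : curveD e eps b m 0 \in class_slope m' by rewrite -mm' imset_f.
case/imsetP => d _ E _.
by have := curve_curve 0 d h; rewrite E eqxx.
Qed.

Lemma class_slope_vert m : class_slope m != class_vert.
Proof.
apply/eqP => h; have : curveD e eps b m 0 \in class_vert by rewrite -h imset_f.
by case/imsetP => k _ E; have := vertical_curve k m 0; rewrite -E eqxx.
Qed.

Lemma parallel_classesE C :
  C \in parallel_classes lines -> C = class_vert \/ exists m, C = class_slope m.
Proof.
case/imsetP => l /A'_lineP[k|m d] ->; first by left; rewrite parallel_vertical.
by right; exists m; rewrite parallel_curve.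
Qed.

Lemma class_vert_in : class_vert \in parallel_classes lines.
Proof. by rewrite -(parallel_vertical 0) imset_f // vertical_in. Qed.

Lemma class_slope_in m : class_slope m \in parallel_classes lines.
Proof. by rewrite -(parallel_curve m 0) imset_f // curveD_in. Qed.

(** The identification of the closure with the projective plane.  The value at
   [inr C] is only meaningful when [C] is a parallel class. *)
Definition ident (p : (K * K) + {set {set K * K}}) : {vspace 'rV[K]_3} :=
  match p with
  | inl p => hpt 1 p.1 (p.2 + w p.1)
  | inr C => if [pick m | C == class_slope m] is Some m then hpt 0 1 m
             else Yinf K
  end.

Lemma ident_slope m : ident (inr (class_slope m)) = hpt 0 1 m.
Proof.
rewrite /=; case: pickP => [m' /eqP/class_slope_inj -> //|/(_ m)].
by rewrite eqxx.
Qed.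

Lemma ident_vert : ident (inr class_vert) = Yinf K.
Proof.
rewrite /=; case: pickP => // m /eqP h.
by have := class_slope_vert m; rewrite h eqxx.
Qed.

(** The points of the closure: affine points and the two kinds of classes. *)
Variant closure_spec : (K * K) + {set {set K * K}} -> Prop :=
| ClosureAff x y : closure_spec (inl (x, y))
| ClosureVert : closure_spec (inr class_vert)
| ClosureSlope m : closure_spec (inr (class_slope m)).

Lemma closureP P : P \in closure_points lines -> closure_spec P.
Proof.
case/setUP => /imsetP[]; first by case=> x y _ ->; constructor.
by move=> C /parallel_classesE[->|[m ->]] ->; constructor.
Qed.

Lemma closure_aff p : inl p \in closure_points lines.
Proof. by apply/setUP; left; apply: imset_f. Qed.

Lemma closure_inf C :
  C \in parallel_classes lines -> inr C \in closure_points lines.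
Proof. by move=> h; apply/setUP; right; apply: imset_f. Qed.

Lemma ident_inj : {in closure_points lines &, injective ident}.
Proof.
move=> P P' /closureP[x y||m] /closureP[x' y'||m'];
  rewrite ?ident_slope ?ident_vert //.
- by move=> /hpt_inj /= [-> /addIr ->].
- by move/eqP; rewrite (negbTE (hpt_neqY _ _)).
- by move/eqP; rewrite (negbTE (hpt_neq01 _ _ _)).
- by move/esym/eqP; rewrite (negbTE (hpt_neqY _ _)).
- by move/esym/eqP; rewrite (negbTE (hpt01_neqY _)).
- by move/esym/eqP; rewrite (negbTE (hpt_neq01 _ _ _)).
- by move/eqP; rewrite (negbTE (hpt01_neqY _)).
- by move/hpt01_inj ->.
Qed.

Lemma ident_closure : ident @: closure_points lines = pg_points K.
Proof.
apply/eqP; rewrite eqEsubset; apply/andP; split; apply/subsetP => P.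
  case/imsetP => _ /closureP[x y||m] ->; rewrite ?ident_slope ?ident_vert;
    by rewrite hpt_pg // ?oner_eq0 ?andbF.
case/pg_pointP => [x y|m|]; apply/imsetP.
- by exists (inl (x, y + w x)); rewrite ?closure_aff //= -addrA addKK addr0.
- exists (inr (class_slope m)); last by rewrite ident_slope.
  by rewrite closure_inf ?class_slope_in.
- by exists (inr class_vert); rewrite ?ident_vert ?closure_inf ?class_vert_in.
Qed.

Lemma ident_vertical k :
  ident @: (inr (parallel_class lines (vertical_line k))
            |: [set inl p | p in vertical_line k]) = line_vert k.
Proof.
rewrite parallel_vertical imsetU1 ident_vert -imset_comp; congr (_ |: _).
apply/setP => P; apply/imsetP/imsetP => [[[x y]]|[y _ ->]].
  by rewrite in_vertical /= => /eqP -> ->; exists (y + w k).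
by exists (k, y + w k); rewrite ?in_vertical //= -addrA addKK addr0.
Qed.

Lemma ident_curve m d :
  ident @: (inr (parallel_class lines (curveD e eps b m d))
            |: [set inl p | p in curveD e eps b m d]) = line_slope m d.
Proof.
rewrite parallel_curve imsetU1 ident_slope -imset_comp; congr (_ |: _).
apply/setP => P; apply/imsetP/imsetP => [[[x y]]|[x _ ->]].
  by rewrite in_curveD /= => /eqP -> ->; exists x.
exists (x, m * x + d + w x); rewrite ?point_on_curve //=.
by rewrite -addrA addKK addr0.
Qed.

Lemma ident_inf :
  ident @: [set inr C | C in parallel_classes lines] = line_inf K.
Proof.
rewrite -imset_comp; apply/setP => P; rewrite in_setU1.
apply/imsetP/orP => [[C /parallel_classesE[->|[m ->]] ->]|].
- by left; rewrite [X in X == _]ident_vert.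
- by right; rewrite [X in X \in _]ident_slope imset_f.
case=> [/eqP ->|/imsetP[m _ ->]].
- by exists class_vert; rewrite ?class_vert_in //; symmetry; exact: ident_vert.
- exists (class_slope m); first exact: class_slope_in.
  by symmetry; exact: ident_slope.
Qed.

Lemma ident_lines :
  [set ident @: l | l : {set _} in closure_lines lines] = pg_lines K.
Proof.
apply/eqP; rewrite eqEsubset; apply/andP; split; apply/subsetP => l.
  case/imsetP => _ /setUP[/imsetP[l' /A'_lineP[k|m d] ->]|/set1P ->] ->.
  - by rewrite ident_vertical line_vert_in.
  - by rewrite ident_curve line_slope_in.
  - by rewrite ident_inf line_inf_in.
case/pg_lineP => [|k|m d]; apply/imsetP.
- eexists; last (symmetry; exact: ident_inf).
  by rewrite in_setU in_set1 eqxx orbT.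
- eexists; last (symmetry; exact: ident_vertical).
  by apply/setUP; left; apply: imset_f; apply: vertical_in.
- eexists; last (symmetry; exact: ident_curve).
  by apply/setUP; left; apply: imset_f; apply: curveD_in.
Qed.

Lemma ident_identification : A'_identification e eps b ident.
Proof.
split; [exact: ident_inj|exact: ident_closure|exact: ident_lines| |].
  move=> xi eta; rewrite /ident /A'_point /= -/q; congr hpt.
  by apply: (eq_mod2 (z := w xi)); rewrite /w; ring.
by rewrite /vertical_infinity -/lines parallel_vertical ident_vert.
Qed.

(** Only the prescribed values of [phi] matter here. *)
Lemma identified_U_b phi : A'_identification e eps b phi ->
  phi @: regard e eps b (U_b e b) = U_eps e eps.
Proof.
case=> _ _ _ phi_aff phi_inf.
have aff x y : phi (inl (x, y)) = hpt 1 x (y + w x).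
  rewrite -phi_aff /A'_point; congr (phi (inl (_, _))).
  by rewrite -/q; apply: (eq_mod2 (z := - w x)); rewrite /w; ring.
rewrite /regard imsetU /U_eps; congr (_ :|: _).
  apply/setP => P; apply/imsetP/imset2P => [[_ /imsetP[[x y] + ->] ->]|].
    rewrite inE in_setU in_set1 (negbTE (hpt_neqY _ _)) orbF aff.
    case/imset2P => x' r _ rq /hpt_inj /= [-> ->]; exists x' r => //.
    congr hpt; apply: (eq_mod2 (z := b * x' ^+ q.+1)); rewrite /w; ring.
  case=> x r _ rq ->; exists (inl (x, b * x ^+ q.+1 + r)).
    apply: imset_f; rewrite inE in_setU; apply/orP; left.
    by apply/imset2P; exists x r.
  rewrite aff; congr hpt.
  apply: (eq_mod2 (z := - (b * x ^+ q.+1))); rewrite /w; ring.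
have Y_U : Yinf K \in U_b e b by rewrite !inE eqxx orbT.
rewrite -[in RHS]phi_inf -(imset_set1 phi); set A := [set c | _].
suff -> : A = [set vertical_infinity e eps b] by [].
by apply/setP => c; rewrite in_set in_set1 Y_U andbT.
Qed.

End Identification.


End Field.

Theorem theorem3p5 (e : nat) (K : finFieldType) (b eps : K) :
  (1 < e)%N -> odd e ->
  #|K| = ((2 ^ e) ^ 2)%N ->
  b \notin GFq e K ->
  BT_parameter e eps ->
  [/\ unital e (U_b e b),
      classical e (U_b e b),
      exists phi, A'_identification e eps b phi
    & forall phi, A'_identification e eps b phi ->
        let S := phi @: regard e eps b (U_b e b) in
        [/\ S = U_eps e eps, unital e S, BT_unital e S & ~ classical e S]].
Proof.
move=> e_gt1 e_odd cardK b_n eps_BT.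
split.
- exact (U_b_unital cardK (card_GFq cardK (trq_eps cardK eps_BT)) b_n).
- exact (U_b_classical cardK b_n).
- by exists (ident e eps b); apply: ident_identification.
move=> phi phiP S; rewrite /S (identified_U_b cardK phiP).
split=> //.
- exact: U_eps_unital.
- exact: U_eps_BT.
- exact: U_eps_not_classical.
Qed.
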